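(* Let $\gamma > 0$ and let $\Pi \in \Delta^{d^N}$ be an arbitrary probability distribution on the scenarios. Define $$\mathcal{Q}^{\mathrm{o}}(\boldsymbol{x},\boldsymbol{u};\Pi) = \tfrac{1}{\gamma} D_{\mathrm{KL}}(\Pi \,\|\, P(\boldsymbol{x})) + \Pi^\top L(\boldsymbol{x},\boldsymbol{u}).$$ Then for all $\boldsymbol{x},\boldsymbol{u}$, $$\mathcal{L}^{\mathrm{o}}(\boldsymbol{x},\boldsymbol{u}) \le \mathcal{Q}^{\mathrm{o}}(\boldsymbol{x},\boldsymbol{u};\Pi).$$
   Context: Data: integers $d, N, n_x, n_u \ge 1$; modes $\Xi = \{1,\dots,d\}$; a matrix $\Theta \in \mathbb{R}^{d \times n_x}$; convex functions $\ell : \mathbb{R}^{n_x}\times\mathbb{R}^{n_u} \to \mathbb{R}$ and $\ell_N : \mathbb{R}^{n_x} \to \mathbb{R}$. Softmax: $\sigma : \mathbb{R}^d \to \mathbb{R}^d$, $\sigma_i(z) = \exp(z_i)/\sum_{j=1}^d \exp(z_j)$. Simplex: $\Delta^n = \{p \in \mathbb{R}^n : p_i \ge 0, \sum_i p_i = 1\}$. Scenario tree: a fully branched rooted tree of depth $N$. $\mathrm{nod}(k)$ is the set of nodes at depth $k$; $\mathrm{nod}(a,b) = \bigcup_{k=a}^b \mathrm{nod}(k)$. The root is node $0$. Each node $\iota \in \mathrm{nod}(0,N-1)$ has exactly $d$ children, one for each mode in $\Xi$; a child $\iota_+$ of $\iota$ carries its mode $\xi^{\iota_+} \in \Xi$.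 Leaves $s \in \mathrm{nod}(N)$ are called scenarios (there are $d^N$ of them), and $\mathrm{anc}(s)$ denotes the nodes on the path from the root to $s$, excluding $s$. For $\iota \in \mathrm{anc}(s)$, $\iota_+$ denotes the child of $\iota$ on the path to $s$. Variables: $\boldsymbol{x} = \{x^\iota\}_{\iota \in \mathrm{nod}(0,N)}$ with $x^\iota \in \mathbb{R}^{n_x}$, and $\boldsymbol{u} = \{u^\iota\}_{\iota \in \mathrm{nod}(0,N-1)}$ with $u^\iota \in \mathbb{R}^{n_u}$. Scenario cost and probability: $L_s(\boldsymbol{x},\boldsymbol{u}) = \ell_N(x^s) + \sum_{\iota \in \mathrm{anc}(s)} \ell(x^\iota,u^\iota)$ and $p(s;\boldsymbol{x}) = \prod_{\iota \in \mathrm{anc}(s)} \sigma_{\xi^{\iota_+}}(\Theta x^\iota)$. $L(\boldsymbol{x},\boldsymbol{u}) \in \mathbb{R}^{d^N}$ and $P(\boldsymbol{x}) \in \Delta^{d^N}$ are the vectors with entries $L_s(\boldsymbol{x},\boldsymbol{u})$ and $p(s;\boldsymbol{x})$. Kullback–Leibler divergence: $D_{\mathrm{KL}}(\Pi\,\|\,P) = \sum_i \Pi_i(\ln \Pi_i - \ln P_i)$, with the convention $0\ln 0 = 0$. Optimistic cost: $\mathcal{L}^{\mathrm{o}}(\boldsymbol{x},\boldsymbol{u}) = -\frac{1}{\gamma} \ln \big( \sum_{s \in \mathrm{nod}(N)} p(s;\boldsymbol{x}) \exp(-\gamma L_s(\boldsymbol{x},\boldsymbol{u})) \big)$. *)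

(* Defs.v *)
From HB Require Import structures.
From mathcomp Require Import all_boot all_order all_algebra.
From mathcomp Require Import all_classical all_reals all_analysis.

Set Implicit Arguments.
Unset Strict Implicit.
Unset Printing Implicit Defensive.

Import Order.TTheory GRing.Theory Num.Theory.

Local Open Scope ring_scope.

Section Distributions.
Context {R : realType}.

Definition softmax (d : nat) (z : 'cV[R]_d) : 'cV[R]_d :=
  \col_i (expR (z i 0) / \sum_(j < d) expR (z j 0)).

(* R^n is represented as {ffun I -> R} for an index type I with n elements. *)
Definition in_simplex (I : finType) (p : {ffun I -> R}) : Prop :=
  (forall i, 0 <= p i) /\ \sum_i p i = 1.

(* The convention 0 ln 0 = 0 holds automatically because [ln] is total.  Since
   [ln 0 = 0], the value is meaningful only if [P i = 0] implies [Pi i = 0];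
   below [P] is a vector of products of softmax values, hence positive. *)
Definition KL (I : finType) (Pi P : {ffun I -> R}) : R :=
  \sum_i Pi i * (ln (Pi i) - ln (P i)).

End Distributions.

Section ScenarioTree.
Context (d N : nat).

(* A node of depth k is the sequence of the k modes met on the path from the
   root, the modes being 'I_d = {0, ..., d - 1} instead of {1, ..., d}; the root
   is [::] and the child of i carrying the mode w is [rcons i w]. *)
Definition node : finType := N.-bseq 'I_d.

Definition inner_node : finType := {i : node | (size i < N)%N}.

Definition scenario : finType := N.-tuple 'I_d.

Definition leaf (s : scenario) : node := bseq_of_tuple s.

Definition anc (s : scenario) : {set inner_node} :=
  finset (fun i : inner_node => prefix (val i) s).

(* For i in [anc s], the child of i on the path to s is the prefix of s of
   length [size i + 1], so the mode that it carries is entry [size i] of s. *)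
Definition next_mode (s : scenario) (i : inner_node) : 'I_d :=
  tnth s (Ordinal (valP i)).

End ScenarioTree.

Section Costs.
Context {R : realType} {d N nx nu : nat}.
Context (Theta : 'M[R]_(d, nx)).
Context (ell : 'cV[R]_nx * 'cV[R]_nu -> R) (ellN : 'cV[R]_nx -> R).
Context (gamma : R).
Implicit Types (x : node d N -> 'cV[R]_nx) (u : inner_node d N -> 'cV[R]_nu).

Definition scenario_cost x u : {ffun scenario d N -> R} :=
  [ffun s => ellN (x (leaf s)) + \sum_(i in anc s) ell (x (val i), u i)].

Definition scenario_prob x : {ffun scenario d N -> R} :=
  [ffun s => \prod_(i in anc s)
               softmax (Theta *m x (val i)) (next_mode s i) 0].

Definition optimistic_cost x u : R :=
  - gamma^-1 * ln (\sum_s scenario_prob x s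
                            * expR (- gamma * scenario_cost x u s)).

Definition optimistic_surrogate x u (Pi : {ffun scenario d N -> R}) : R :=
  gamma^-1 * KL Pi (scenario_prob x) + \sum_s Pi s * scenario_cost x u s.

End Costs.

(* Main.v *)
Require Import Defs.
From HB Require Import structures.
From mathcomp Require Import all_boot all_order all_algebra.
From mathcomp Require Import all_classical all_reals all_analysis.
From mathcomp Require Import ring lra.

Set Implicit Arguments.
Unset Strict Implicit.
Unset Printing Implicit Defensive.

Import Order.TTheory GRing.Theory Num.Theory.

Local Open Scope ring_scope.

(** The inequality is one half of the Gibbs (Donsker-Varadhan) variational
    formula for the log-partition function.  Put
    [a s = p(s; x) * exp(- gamma * L_s)].  Since every [p(s; x)] is positive,
    [ln (a s) = ln (p(s; x)) - gamma * L_s], so multiplying the surrogate by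
    [gamma] turns it into the single divergence [KL Pi a], while [gamma] times
    the optimistic cost is [- ln (\sum_s a s)].  What remains is that a
    probability vector has divergence at least [- ln (\sum_s a s)] from an
    unnormalised positive weight [a] ([KL_ge_ln_sum]).  That bound is the sum
    over [s], after normalising [a], of the tangent-line inequality
    [ln y <= y - 1] ([mul_ln_sub_ge]). *)

(** This is [ln y <= y - 1] at [y = q / p], multiplied by [p].  At [p = 0],
    the left-hand side is nonpositive and the right-hand side vanishes
    whatever [ln 0] is, so the bound covers the convention [0 ln 0 = 0]. *)
Lemma mul_ln_sub_ge (R : realType) (p q : R) :
  0 <= p -> 0 < q -> p - q <= p * (ln p - ln q).
Proof.
move=> p_ge0 q_gt0; have [->|p_neq0] := eqVneq p 0.
  by rewrite mul0r sub0r oppr_le0 ltW.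
have p_gt0 : 0 < p by rewrite lt0r p_neq0.
have y_gt0 : 0 < q / p by rewrite divr_gt0.
have : ln (q / p) <= q / p - 1.
  by rewrite -{1}[q / p](subrKC 1) le_ln1Dx // ltrBrDl subrr.
rewrite -(ler_pM2l p_gt0) ln_div ?posrE //.
have -> : p * (q / p - 1) = q - p by field.
lra.
Qed.

(** Normalising [q] to [q / \sum_i q i] shifts the divergence by
    [ln (\sum_i q i)], and the termwise bounds against the normalised weight
    sum to [1 - 1 = 0]. *)
Lemma KL_ge_ln_sum (R : realType) (I : finType) (p q : {ffun I -> R}) :
  in_simplex p -> (forall i, 0 < q i) -> - ln (\sum_i q i) <= KL p q.
Proof.
move=> [p_ge0 p_sum1] q_gt0; set S := \sum_i q i.
have S_gt0 : 0 < S.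
  (* An empty sum of the [p i] could not be [1], so [I] is inhabited. *)
  have [i _|I0] := pickP (@predT I).
    by rewrite /S (bigD1 i) //= ltr_pwDl // sumr_ge0 // => j _; apply: ltW.
  by move/eqP: p_sum1; rewrite big_pred0 // eq_sym oner_eq0.
have termwise : \sum_i (p i - q i / S) <= \sum_i p i * (ln (p i) - ln (q i / S)).
  by apply: ler_sum => i _; apply: mul_ln_sub_ge; rewrite ?divr_gt0.
have shift : \sum_i p i * (ln (p i) - ln (q i / S)) = KL p q + ln S.
  rewrite /KL -[ln S]mul1r -p_sum1 mulr_suml -big_split /=.
  apply: eq_bigr => i _.
  by rewrite ln_div ?posrE //; ring.
move: termwise; rewrite shift sumrB -mulr_suml p_sum1 divff ?gt_eqF // subrr.
lra.
Qed.

Lemma softmax_gt0 (R : realType) (d : nat) (z : 'cV[R]_d) (i : 'I_d) :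
  0 < softmax z i 0.
Proof.
rewrite mxE divr_gt0 ?expR_gt0 // (bigD1 i) //= ltr_pwDl ?expR_gt0 //.
by apply: sumr_ge0 => j _; apply: expR_ge0.
Qed.

Lemma scenario_prob_gt0 (R : realType) (d N nx : nat) (Theta : 'M[R]_(d, nx))
    (x : node d N -> 'cV[R]_nx) (s : scenario d N) :
  0 < scenario_prob Theta x s.
Proof. by rewrite ffunE; apply: prodr_gt0 => i _; apply: softmax_gt0. Qed.

(** The logarithm of the tilting factor is linear, so an expected cost added
    to a divergence is absorbed into the reference weight: the free energy on
    the right is itself a divergence. *)
Lemma KL_tilt (R : realType) (I : finType) (p q c : {ffun I -> R}) (g : R) :
  (forall i, 0 < q i) ->
  KL p [ffun i => q i * expR (- g * c i)] = KL p q + g * \sum_i p i * c i.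
Proof.
move=> q_gt0; rewrite /KL mulr_sumr -big_split /=; apply: eq_bigr => i _.
rewrite ffunE lnM ?posrE ?expR_gt0 // expRK; ring.
Qed.

Theorem proposition1 (R : realType) (d N nx nu : nat)
    (hd : (1 <= d)%N) (hN : (1 <= N)%N) (hnx : (1 <= nx)%N) (hnu : (1 <= nu)%N)
    (Theta : 'M[R]_(d, nx))
    (ell : 'cV[R]_nx * 'cV[R]_nu -> R) (ellN : 'cV[R]_nx -> R)
    (ell_convex :
       @convex_function R ('cV[R]_nx * 'cV[R]_nu)%type [set: _]%classic ell)
    (ellN_convex : @convex_function R 'cV[R]_nx [set: _]%classic ellN)
    (gamma : R) (hgamma : 0 < gamma)
    (Pi : {ffun scenario d N -> R}) (hPi : in_simplex Pi)
    (x : node d N -> 'cV[R]_nx) (u : inner_node d N -> 'cV[R]_nu) :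
  optimistic_cost Theta ell ellN gamma x u
    <= optimistic_surrogate Theta ell ellN gamma x u Pi.
Proof.
have P_gt0 := scenario_prob_gt0 Theta x.
set P := scenario_prob Theta x in P_gt0 *.
set L := scenario_cost ell ellN x u.
have gibbs := @KL_ge_ln_sum R _ Pi [ffun s => P s * expR (- gamma * L s)] hPi.
rewrite KL_tilt // in gibbs.
rewrite /optimistic_cost /optimistic_surrogate -/P -/L.
have -> : \sum_s P s * expR (- gamma * L s)
    = \sum_s [ffun s => P s * expR (- gamma * L s)] s.
  by apply: eq_bigr => s _; rewrite ffunE.
rewrite -(ler_pM2l hgamma) mulrDr !mulrA mulrN divff ?gt_eqF //.
rewrite mulN1r mul1r; apply: gibbs => s.
by rewrite ffunE mulr_gt0 ?expR_gt0.
Qed.
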